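(* Let $R$ be an integral domain with field of fractions $F$, let $f,g\in R[X]$ be monic polynomials of degree $n\ge1$ with companion matrices $C,D\in M_n(R)$, let $d=\gcd(f,g)\in F[X]$ and let $m=\deg d$. Then the $n+(n-m)(n-1)$ matrices $$I,C,\dots,C^{n-1},\ D,CD,\dots,C^{n-m-1}D,\ \dots,\ D^{n-1},CD^{n-1},\dots,C^{n-m-1}D^{n-1}$$ span $R\langle C,D\rangle$ as an $R$-module if and only if $d\in R[X]$. In particular, $R\langle C,D\rangle$ is a free $R$-module of rank $n+(n-m)(n-1)$ provided $d\in R[X]$, and in particular if $R$ is integrally closed.
   Context: For monic $f=f_0+f_1X+\cdots+f_{n-1}X^{n-1}+X^n\in R[X]$ the companion matrix $C_f\in M_n(R)$ has $1$'s on the first subdiagonal, last column $(-f_0,\dots,-f_{n-1})^T$, and $0$'s elsewhere. $R\langle C,D\rangle$ is the (unital) $R$-subalgebra of $M_n(R)$ generated by $C$ and $D$. The gcd is monic and taken in $F[X]$. The listed matrices are the $C^i$ for $0\le i\le n-1$ together with the $C^iD^j$ for $0\le i\le n-m-1$, $1\le j\le n-1$ (none of the latter if $m=n$). $R$ is integrally closed if every root in $F$ of a monic polynomial in $R[X]$ lies in $R$. *)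

(* Defs.v *)
From HB Require Import structures.
From mathcomp Require Import all_boot all_order all_algebra.

Set Implicit Arguments.
Unset Strict Implicit.
Unset Printing Implicit Defensive.

Import GRing.Theory.
Local Open Scope ring_scope.

(* MathComp's companionmx has the coefficients in its last row and dimension
   (size f).-1.  Here they are in the last column, and the size n is explicit,
   so that the companion matrices of two polynomials of the same degree have
   the same type. *)
Definition companion (R : nzRingType) (n : nat) (f : {poly R}) : 'M[R]_n :=
  \matrix_(i < n, j < n)
    if j.+1 == n :> nat then - f`_i else (i == j.+1 :> nat)%:R.

Lemma companion_tr (R : nzRingType) (f : {poly R}) :
  companion (size f).-1 f = (companionmx f)^T.
Proof.
have predE k a : (a < k)%N -> (a.+1 == k) = (a == k.-1) by case: k.
by apply/matrixP => i j; rewrite !mxE predE // (eq_sym (i : nat)).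
Qed.

Inductive in_alg2 (R : nzRingType) (n : nat) (C D : 'M[R]_n) :
    'M[R]_n -> Prop :=
| in_alg2_1 : in_alg2 C D 1%:M
| in_alg2_l : in_alg2 C D C
| in_alg2_r : in_alg2 C D D
| in_alg2_add A B : in_alg2 C D A -> in_alg2 C D B -> in_alg2 C D (A + B)
| in_alg2_scale a A : in_alg2 C D A -> in_alg2 C D (a *: A)
| in_alg2_mul A B : in_alg2 C D A -> in_alg2 C D B -> in_alg2 C D (A *m B).

Definition in_span (R : nzRingType) (V : lmodType R) (s : seq V) (v : V) :=
  exists c : 'I_(size s) -> R, v = \sum_(i < size s) c i *: s`_i.

Definition spans (R : nzRingType) (V : lmodType R) (s : seq V)
    (M : V -> Prop) :=
  forall v, M v <-> in_span s v.

(* For a submodule M of V. Coefficients are finite functions so that exists!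
   refers to pointwise equality. *)
Definition free_of_rank (R : nzRingType) (V : lmodType R) (M : V -> Prop)
    (r : nat) :=
  exists e : 'I_r -> V,
    (forall i, M (e i)) /\
    (forall v, M v ->
       exists! c : {ffun 'I_r -> R}, v = \sum_(i < r) c i *: e i).

Definition listed (R : nzRingType) (n m : nat) (C D : 'M[R]_n) :
    seq 'M[R]_n :=
  [seq C ^+ i | i <- iota 0 n] ++
  [seq C ^+ i *m D ^+ j | j <- iota 1 n.-1, i <- iota 0 (n - m)].

Lemma size_listed (R : nzRingType) (n m : nat) (C D : 'M[R]_n) :
  size (listed m C D) = (n + (n - m) * n.-1)%N.
Proof. by rewrite size_cat size_map size_allpairs !size_iota mulnC. Qed.

(* gcdp is only determined up to a unit, hence the normalisation. *)
Definition monic_gcd (F : fieldType) (p q : {poly F}) : {poly F} :=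
  (lead_coef (gcdp p q))^-1 *: gcdp p q.

Definition to_frac_poly (R : idomainType) (p : {poly R}) :
    {poly {fraction R}} :=
  map_poly (@tofrac R) p.

Definition has_coefs_in_base (R : idomainType) (p : {poly {fraction R}}) :=
  exists q : {poly R}, p = to_frac_poly q.

Definition integrally_closed (R : idomainType) :=
  forall (p : {poly R}) (x : {fraction R}),
    p \is monic -> root (to_frac_poly p) x -> exists a : R, x = tofrac a.

(* Main.v *)
Require Import Defs.
From HB Require Import structures.
From mathcomp Require Import all_boot all_order all_algebra.
Import GRing.Theory Pdiv.CommonRing Pdiv.RingMonic.
Local Open Scope ring_scope.

(** Write h = g - f, a polynomial of degree < n, let e_0, ..., e_(n-1) be the
    standard basis of R^n, and identify R^n with R[X]/(f), so that C is
    multiplication by X and C^i e_0 = e_i for i < n.  Then C - D = w e_(n-1)^T,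
    where w = h(C) e_0 is the coefficient vector of h.

    Let J = R[C] w, which is the ideal generated by h in R[X]/(f).  The algebra
    R<C,D> is R[C] + {B : all columns of B lie in J}: this set contains C and D
    and is closed under products, and conversely each w e_j^T is obtained from
    w e_(n-1)^T by repeated right multiplication by D.  For q in R[X] the first
    column of (qh)(C) is q(C) w, so the first column of B can be moved into
    R[C]: every element of R<C,D> is p(C) + B with deg p < n and B having first
    column 0 and all other columns in J, uniquely.

    Everything thus depends on J.  Put k = n - m and f1 = f / d in F[X], which
    is monic of degree k.  For r in R[X], r(C) w = 0 iff f divides r h, and this
    forces f1 to divide r; so w, Cw, ..., C^(k-1) w are always independent.  If
    d is in R[X], then so is f1, it annihilates w, and division by f1 shows that
    these k vectors span J.  Conversely, a monic r of degree k in R[X] with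
    r(C) w = 0 must be equal to f1, whence f1 and d = f / f1 are in R[X].

    For 0 < j < n, the columns of D^j - C^j are in J; those of index < n - j
    vanish and the one of index n - j is - w.  If w, ..., C^(k-1) w span J, the
    C^i (D^j - C^j) with i < k therefore eliminate the columns of B from left to
    right, so the listed matrices span.  If the listed matrices span and n > 1,
    comparing the columns of index 1 in an expansion of C^k w e_1^T gives a
    monic r of degree k that annihilates w.  For n = 1 both d = 1 and d = f have
    coefficients in R.

    Finally, d is a monic divisor over F of the monic polynomial f in R[X], so
    its coefficients are integral over R ([integral_monic_divisor]), and lie in
    R if R is integrally closed. *)

Set Implicit Arguments.
Unset Strict Implicit.
Unset Printing Implicit Defensive.

(** * Integrality of the coefficients of monic divisors *)

Lemma qpolyC_inj (K : comNzRingType) (d : {poly K}) : injective (qpolyC d).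
Proof. by move=> a b /(congr1 val)/polyC_inj. Qed.

Lemma root_qpolyX (K : comNzRingType) (d : {poly K}) :
  (1 < size d)%N -> d \is monic -> root (map_poly (qpolyC d) d) (qpolyX d).
Proof.
move=> d_gt1 d_monic.
have evalE p : (map_poly (qpolyC d) p).[qpolyX d] = in_qpoly d p.
  elim/poly_ind: p => [|p c IHp]; first by rewrite rmorph0 horner0 in_qpoly0.
  rewrite rmorphD rmorphM /= map_polyX map_polyC /= hornerMXaddC IHp.
  rewrite in_qpolyD in_qpolyM; congr (_ + _).
  apply/val_inj => /=; rewrite rmodp_small //.
  by rewrite (leq_ltn_trans (size_polyC_leq1 _)) ?size_mk_monic_gt1.
rewrite /root evalE; apply/eqP/val_inj => /=.
by rewrite /mk_monic d_gt1 d_monic rmodpp.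
Qed.

(** The coefficients of a monic divisor d of a monic polynomial over R are
    integral over R.  In K[X]/(d) the polynomial d has the root X, which is
    integral, and the cofactor of that root is again a monic divisor of smaller
    degree.  Since K may be any commutative ring, d need not be irreducible and
    no splitting field is required. *)
Lemma integral_monic_divisor (R K : comNzRingType) (iota : {rmorphism R -> K})
    (p : {poly R}) (d e : {poly K}) :
    p \is monic -> d \is monic -> map_poly iota p = d * e ->
  forall i, integralOver iota d`_i.
Proof.
move=> p_monic; move: {2}(size d) (leqnn (size d)) => s.
elim: s K iota d e => [|s IHs] K iota d e.
  by rewrite leqn0 size_poly_eq0 => /eqP-> /monic_neq0/eqP.
move=> d_le d_monic p_eq i.
have [d_le1|d_gt1] := leqP (size d) 1.
  have -> : d = 1.
    move/monicP: d_monic; rewrite (size1_polyC d_le1) lead_coefC => -> //.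
  by rewrite coef1; apply: integral_nat.
pose K' : comNzRingType := {poly %/ d}.
pose emb : {rmorphism K -> K'} := qpolyC d.
pose iota' : {rmorphism R -> K'} := emb \o iota.
pose x : K' := qpolyX d.
have dx0 : root (map_poly emb d) x by apply: root_qpolyX.
have [d1 d_eq] := factor_theorem _ _ dx0.
have d1_monic : d1 \is monic.
  by rewrite -(monicMr _ (monicXsubC x)) -d_eq monic_map.
have p_eq' : map_poly iota' p = d1 * (('X - x%:P) * map_poly emb e).
  by rewrite mulrA -d_eq -rmorphM /= -p_eq -map_poly_comp.
have d1_le : (size d1 <= s)%N.
  have := d_le; rewrite -(size_map_inj_poly (@qpolyC_inj _ d) (rmorph0 emb)).
  by rewrite [map_poly _ _]d_eq size_Mmonic ?monicXsubC ?monic_neq0 //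
    size_XsubC addn2.
have d1_int := IHs _ iota' d1 _ d1_le d1_monic p_eq'.
have x_int : integralOver iota' x.
  exists p; first exact: p_monic.
  by rewrite p_eq' mulrA -d_eq /root hornerM (rootP dx0) mul0r.
(* An integral equation over K[X]/(d) for an element of K already holds in K,
   because K embeds in K[X]/(d). *)
have : integralOver iota' (emb d`_i).
  rewrite -coef_map d_eq mulrBr coefB coefMX coefMC.
  apply: integral_sub; last exact: integral_mul.
  by case: ifP => _; [apply: integral0 | apply: d1_int].
case=> q q_monic; rewrite /root map_poly_comp horner_map => q_root.
exists q => //; apply/eqP/(@qpolyC_inj _ d).
by rewrite (eqP q_root) qpolyC0.
Qed.

(** * Monic gcd over the fraction field *)

(** Division by a monic polynomial over R is the same over R and over K, so an
    exact quotient over K has coefficients in R. *)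
Lemma map_poly_monic_cofactor (R K : idomainType) (iota : {rmorphism R -> K})
    (p a : {poly R}) (b : {poly K}) :
    injective iota -> a \is monic -> map_poly iota p = map_poly iota a * b ->
  exists2 q, b = map_poly iota q & p = a * q.
Proof.
move=> iota_inj a_monic p_eq; pose q := rdivp p a; pose r := rmodp p a.
have p_div : p = q * a + r by apply: rdivp_eq.
have amap_monic : map_poly iota a \is monic by apply: monic_map.
have r_eq : map_poly iota r = (b - map_poly iota q) * map_poly iota a.
  rewrite mulrBl [b * _]mulrC -p_eq [in map_poly iota p]p_div rmorphD rmorphM.
  by rewrite /= addrAC subrr add0r.
have r_size : (size (map_poly iota r) < size (map_poly iota a))%N.
  rewrite !size_map_inj_poly ?rmorph0 //.
  by rewrite ltn_rmodp monic_neq0.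
have b_eq : b = map_poly iota q.
  apply/eqP; rewrite -subr_eq0; apply: contraLR r_size => nz.
  rewrite r_eq size_Mmonic // -leqNgt.
  by rewrite -(prednK (n := size (b - _))) ?size_poly_gt0 // addSn leq_addl.
exists q => //; rewrite p_div (_ : r = 0) ?addr0 1?mulrC //.
apply: (map_inj_poly iota_inj (rmorph0 iota)).
by rewrite r_eq b_eq subrr mul0r rmorph0.
Qed.

Section GcdOverFractions.

Variables (R : idomainType) (f g : {poly R}).
Hypotheses (f_monic : f \is monic) (g_monic : g \is monic).

Let F : fieldType := {fraction R}.
Let tf : {rmorphism R -> F} := @tofrac R.
Let d : {poly F} := monic_gcd (to_frac_poly f) (to_frac_poly g).

Lemma tofrac_inj : injective (@tofrac R).
Proof. by move=> a b /eqP; rewrite tofrac_eq => /eqP. Qed.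

Lemma size_to_frac_poly (p : {poly R}) : size (to_frac_poly p) = size p.
Proof. exact: (size_map_inj_poly tofrac_inj (rmorph0 tf)). Qed.

Lemma to_frac_poly_monic (p : {poly R}) :
  (to_frac_poly p \is monic) = (p \is monic).
Proof.
rewrite !monicE /to_frac_poly lead_coef_map_inj ?tofrac0 //;
  last exact: tofrac_inj.
by rewrite -(inj_eq tofrac_inj) tofrac1.
Qed.

Let fF_monic : to_frac_poly f \is monic.
Proof. by rewrite to_frac_poly_monic. Qed.

Lemma eqp_monic_gcd : d %= gcdp (to_frac_poly f) (to_frac_poly g).
Proof.
apply: eqp_scale; rewrite invr_eq0 lead_coef_eq0 gcdp_eq0 negb_and.
by rewrite monic_neq0.
Qed.

Lemma monic_gcd_monic : d \is monic.
Proof.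
rewrite monicE /d /monic_gcd lead_coefZ mulVf; first exact: eqxx.
rewrite lead_coef_eq0 gcdp_eq0 negb_and.
by rewrite monic_neq0.
Qed.

Lemma monic_gcd_dvdl : d %| to_frac_poly f.
Proof. by rewrite (eqp_dvdl _ eqp_monic_gcd) dvdp_gcdl. Qed.

Lemma monic_gcd_dvdr : d %| to_frac_poly g.
Proof. by rewrite (eqp_dvdl _ eqp_monic_gcd) dvdp_gcdr. Qed.

(** f divides both p f and p g, hence their gcd p d up to a unit; then cancel d
    in f. *)
Lemma monic_gcd_cofactorP (p : {poly F}) :
  to_frac_poly f %| p * to_frac_poly g -> to_frac_poly f %/ d %| p.
Proof.
move=> f_dvd; rewrite -(dvdp_mul2r _ _ (monic_neq0 monic_gcd_monic)).
rewrite divpK ?monic_gcd_dvdl // (eqp_dvdr _ (eqp_mull p eqp_monic_gcd)).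
by rewrite (eqp_dvdr _ (mulp_gcdr _ _ _)) dvdp_gcd dvdp_mull.
Qed.

Lemma size_monic_gcd_cofactor n : size f = n.+1 ->
  size (to_frac_poly f %/ d) = (n - (size d).-1).+1.
Proof.
move=> f_size; rewrite size_divp ?monic_neq0 ?monic_gcd_monic //.
rewrite size_to_frac_poly f_size subSn //.
have := dvdp_leq (monic_neq0 fF_monic) monic_gcd_dvdl.
rewrite size_to_frac_poly f_size.
by rewrite (polySpred (monic_neq0 monic_gcd_monic)).
Qed.

(** The witness is f / d: if f = d f1 and g = d g1, then
    f1 (g - f) = (g1 - f1) f. *)
Lemma base_gcd_annihilator n : size f = n.+1 -> has_coefs_in_base d ->
  exists f1, [/\ f1 \is monic, size f1 = (n - (size d).-1).+1 &
    exists q, f1 * (g - f) = q * f].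
Proof.
move=> f_size [d0 d_eq].
have d0_monic : d0 \is monic.
  by rewrite -to_frac_poly_monic -d_eq monic_gcd_monic.
have := divpK monic_gcd_dvdl; rewrite mulrC {1}d_eq => /esym.
case/(map_poly_monic_cofactor tofrac_inj d0_monic) => f1 f1_eq f_eq.
have := divpK monic_gcd_dvdr; rewrite mulrC {1}d_eq => /esym.
case/(map_poly_monic_cofactor tofrac_inj d0_monic) => g1 _ g_eq.
exists f1; split.
- by rewrite -(monicMl _ d0_monic) -f_eq.
- by rewrite -(size_monic_gcd_cofactor f_size) f1_eq size_to_frac_poly.
- by exists (g1 - f1); rewrite g_eq f_eq -mulrBr mulrCA [f1 * _]mulrC mulrCA.
Qed.

Lemma annihilator_dvd (r q : {poly R}) : r * (g - f) = q * f ->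
  to_frac_poly f %/ d %| to_frac_poly r.
Proof.
move=> r_eq; apply: monic_gcd_cofactorP.
have -> : to_frac_poly r * to_frac_poly g =
    to_frac_poly (q + r) * to_frac_poly f.
  by rewrite /to_frac_poly -!rmorphM mulrDl -r_eq mulrBr subrK.
by rewrite dvdp_mull.
Qed.

Lemma annihilator_small n (r q : {poly R}) : size f = n.+1 ->
    (size r <= n - (size d).-1)%N -> r * (g - f) = q * f ->
  r = 0.
Proof.
move=> f_size r_size /annihilator_dvd r_dvd; apply/eqP; apply: contraTT r_size.
move=> r_neq0; rewrite -ltnNge -(size_monic_gcd_cofactor f_size)
  -(size_to_frac_poly r).
by apply: dvdp_leq => //; rewrite -size_poly_eq0 size_to_frac_poly
  size_poly_eq0.
Qed.

Lemma annihilator_base_gcd n (r q : {poly R}) : size f = n.+1 ->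
    r \is monic -> size r = (n - (size d).-1).+1 -> r * (g - f) = q * f ->
  has_coefs_in_base d.
Proof.
move=> f_size r_monic r_size /annihilator_dvd r_dvd.
have cof_monic : to_frac_poly f %/ d \is monic.
  by rewrite -(monicMr _ monic_gcd_monic) divpK ?monic_gcd_dvdl.
have cof_eq : to_frac_poly f %/ d = to_frac_poly r.
  apply/eqP; rewrite -eqp_monic ?to_frac_poly_monic //.
  by rewrite -dvdp_size_eqp // size_to_frac_poly r_size
    (size_monic_gcd_cofactor f_size).
have := divpK monic_gcd_dvdl; rewrite cof_eq => /esym.
by case/(map_poly_monic_cofactor tofrac_inj r_monic) => d0 d_eq _; exists d0.
Qed.

Lemma integrally_closed_base_gcd : integrally_closed R -> has_coefs_in_base d.
Proof.
move=> closedR.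
have := divpK monic_gcd_dvdl; rewrite mulrC => /esym f_eq.
have d_int := integral_monic_divisor (iota := tf) f_monic monic_gcd_monic f_eq.
have d_base (i : 'I_(size d)) : exists a, d`_i = tf a.
  by have [p p_monic] := d_int i; apply: closedR p_monic.
have [a a_eq] := fin_all_exists d_base.
exists (\poly_(i < size d) if insub i is Some j then a j else 0).
apply/polyP => i; rewrite coef_map coef_poly.
case: ltnP => [lt_i|/(nth_default 0)->]; last by rewrite /= tofrac0.
by rewrite insubT; apply: (a_eq (Ordinal lt_i)).
Qed.

(** In degree one, d is 1 or f. *)
Lemma deg1_base_gcd : size f = 2%N -> has_coefs_in_base d.
Proof.
move=> f_size; have d_le : (size d <= 2)%N.
  by rewrite -f_size -size_to_frac_poly dvdp_leq ?monic_neq0 // monic_gcd_dvdl.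
have [d_size|d_neq2] := eqVneq (size d) 2%N.
  exists f; apply/eqP; rewrite -eqp_monic ?monic_gcd_monic //.
  by rewrite -dvdp_size_eqp ?monic_gcd_dvdl // d_size size_to_frac_poly f_size.
have d_le1 : (size d <= 1)%N by rewrite -ltnS ltn_neqAle d_neq2.
exists 1; rewrite /to_frac_poly rmorph1.
by move/monicP: monic_gcd_monic; rewrite (size1_polyC d_le1) lead_coefC => ->.
Qed.

End GcdOverFractions.

(** * Spans and free submodules *)

Section SpanClosure.

Variables (R : nzRingType) (V : lmodType R).

Lemma in_spanD (s : seq V) u v : in_span s u -> in_span s v -> in_span s (u +
  v).
Proof.
move=> [a ->] [b ->]; exists (fun i => a i + b i).
by rewrite -big_split; apply: eq_bigr => i _; rewrite scalerDl.
Qed.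

Lemma in_spanZ (s : seq V) a v : in_span s v -> in_span s (a *: v).
Proof.
move=> [b ->]; exists (fun i => a * b i).
by rewrite scaler_sumr; apply: eq_bigr => i _; rewrite scalerA.
Qed.

Lemma in_span0 (s : seq V) : in_span s 0.
Proof.
by exists (fun=> 0); rewrite big1 // => i _; rewrite scale0r.
Qed.

Lemma in_span_sum (I : Type) (r : seq I) (P : pred I) (s : seq V) (v : I -> V) :
  (forall i, P i -> in_span s (v i)) -> in_span s (\sum_(i <- r | P i) v i).
Proof.
by move=> sv; elim/big_ind: _ => //; [apply: in_span0 | apply: in_spanD].
Qed.

Lemma mem_in_span (s : seq V) v : v \in s -> in_span s v.
Proof.
move=> /(nthP 0)[i lt_i <-]; exists (fun j => (j == Ordinal lt_i)%:R).
rewrite (bigD1 (Ordinal lt_i)) //= eqxx scale1r big1 ?addr0 // => j /negPf->.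
by rewrite scale0r.
Qed.

Lemma in_span_ind (s : seq V) (P : V -> Prop) :
    P 0 -> (forall u v, P u -> P v -> P (u + v)) ->
    (forall a v, P v -> P (a *: v)) -> (forall v, v \in s -> P v) ->
  forall v, in_span s v -> P v.
Proof.
move=> P0 PD PZ Ps v [c ->]; elim/big_ind: _ => // i _.
by apply/PZ/Ps/mem_nth.
Qed.

(** A basis may be indexed by any finite type. *)
Lemma free_of_rank_finType (M : V -> Prop) (T : finType) (e : T -> V) :
    (forall x, M (e x)) ->
    (forall v, M v -> exists c : T -> R, v = \sum_x c x *: e x) ->
    (forall c : T -> R, \sum_x c x *: e x = 0 -> forall x, c x = 0) ->
  free_of_rank M #|T|.
Proof.
move=> Me genM freeM; exists (fun i => e (enum_val i)); split=> // v Mv.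
have sumE (c : T -> R) :
    \sum_x c x *: e x = \sum_(i < #|T|) c (enum_val i) *: e (enum_val i).
  exact: (big_enum_val (fun x => c x *: e x)).
have [c ->] := genM v Mv; exists [ffun i => c (enum_val i)]; split.
  by rewrite sumE; apply: eq_bigr => i _; rewrite ffunE.
move=> c' c'_eq; apply/ffunP => i; rewrite ffunE; apply/eqP; rewrite -subr_eq0.
have := freeM (fun x => c x - c' (enum_rank x)); rewrite sumE.
under eq_bigr do rewrite enum_valK scalerBl.
rewrite sumrB -sumE -c'_eq subrr => /(_ erefl (enum_val i)).
by rewrite enum_valK => ->.
Qed.

End SpanClosure.

(** * Polynomials in a companion matrix *)

Lemma poly_coef_small (R : nzRingType) (p : {poly R}) n :
  (size p <= n)%N -> \poly_(i < n) p`_i = p.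
Proof.
move=> le_n; apply/polyP => i; rewrite coef_poly.
by case: ltnP => // /(leq_trans le_n)/(nth_default 0).
Qed.

Lemma horner_mx_poly (R : comNzRingType) n (A : 'M[R]_n.+1) k (c : nat -> R) :
  horner_mx A (\poly_(i < k) c i) = \sum_(i < k) c i *: A ^+ i.
Proof.
rewrite poly_def linear_sum; apply: eq_bigr => i _.
by rewrite linearZ rmorphXn /= horner_mx_X.
Qed.

Lemma col_mulmx (R : comNzRingType) m n p (A : 'M[R]_(m, n)) (B : 'M[R]_(n,
  p)) j :
  col j (A *m B) = A *m col j B.
Proof. by rewrite !colE mulmxA. Qed.

Lemma char_poly_trmx (R : comNzRingType) n (A : 'M[R]_n) :
  char_poly A^T = char_poly A.
Proof.
rewrite /char_poly -[RHS]det_tr; congr (\det _).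
by apply/matrixP => i j; rewrite !mxE eq_sym.
Qed.

Section Companion.

Variables (R : comNzRingType) (n : nat) (f : {poly R}).
Hypotheses (f_monic : f \is monic) (f_size : size f = n.+2).

Let C : 'M[R]_n.+1 := companion n.+1 f.

Implicit Type p : {poly R}.

Lemma companion_delta (j k : 'I_n.+1) :
  k = j.+1 :> nat -> C *m delta_mx j (0 : 'I_1) = delta_mx k 0.
Proof.
move=> k_eq; rewrite -colE; apply/colP => i; rewrite !mxE eqxx andbT.
by rewrite -k_eq ltn_eqF // -val_eqE.
Qed.

Lemma companion_exp_delta t (j k : 'I_n.+1) :
  k = (t + j)%N :> nat -> C ^+ t *m delta_mx j (0 : 'I_1) = delta_mx k 0.
Proof.
elim: t k => [|t IHt] k k_eq.
  by rewrite expr0 mul1mx; congr delta_mx; apply/val_inj.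
have lt_tj : (t + j < n.+1)%N by rewrite ltnW // -addSn -k_eq.
by rewrite exprS -mulmxA (IHt (Ordinal lt_tj)) // (@companion_delta _ k).
Qed.

Lemma horner_companion_root : horner_mx C f = 0.
Proof.
have f_eq m : m = (size f).-1 -> char_poly (companion m f) = f.
  by move=> ->; rewrite companion_tr char_poly_trmx companionmxK.
by rewrite -[X in horner_mx _ X](f_eq n.+1) ?f_size //; apply: Cayley_Hamilton.
Qed.

Lemma horner_companion_modp p : horner_mx C (rmodp p f) = horner_mx C p.
Proof.
rewrite [in RHS](rdivp_eq f_monic p) rmorphD rmorphM /=.
by rewrite horner_companion_root mulr0 add0r.
Qed.

Lemma size_modp_companion (p : {poly R}) : (size (rmodp p f) <= n.+1)%N.
Proof. by rewrite -ltnS -f_size ltn_rmodp monic_neq0. Qed.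

(** The first column of p(C) lists the coefficients of p. *)
Lemma horner_companion_delta0 p : (size p <= n.+1)%N ->
  horner_mx C p *m delta_mx 0 (0 : 'I_1) = \col_i p`_i.
Proof.
move=> p_size; rewrite -{1}(poly_coef_small p_size) horner_mx_poly mulmx_suml.
rewrite (eq_bigr (fun i : 'I_n.+1 => p`_i *: delta_mx i 0)) => [|i _].
  apply/colP => i; rewrite summxE (bigD1 i) //= !mxE !eqxx mulr1 big1 ?addr0 //.
  by move=> j /negPf nji; rewrite !mxE eq_sym nji mulr0.
by rewrite -scalemxAl (@companion_exp_delta _ _ i) // addn0.
Qed.

Lemma horner_companion_eq0 p :
  horner_mx C p *m delta_mx 0 (0 : 'I_1) = 0 -> rmodp p f = 0.
Proof.
rewrite -horner_companion_modp horner_companion_delta0 ?size_modp_companion //.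
move=> /colP p0; apply/polyP => i; rewrite coef0.
have [lt_i|le_i] := ltnP i n.+1; first by have := p0 (Ordinal lt_i);
  rewrite !mxE.
by rewrite nth_default // (leq_trans (size_modp_companion p)).
Qed.

Lemma horner_companion_inj p : (size p <= n.+1)%N ->
  horner_mx C p *m delta_mx 0 (0 : 'I_1) = 0 -> p = 0.
Proof.
by move=> p_size /horner_companion_eq0; rewrite rmodp_small // f_size.
Qed.

End Companion.

(** * The algebra generated by two companion matrices *)

Section TwoCompanions.

Variables (R : comNzRingType) (n : nat) (f g : {poly R}).
Hypotheses (f_monic : f \is monic) (f_size : size f = n.+2).
Hypotheses (g_monic : g \is monic) (g_size : size g = n.+2).

Let C : 'M[R]_n.+1 := companion n.+1 f.
Let D : 'M[R]_n.+1 := companion n.+1 g.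
(* The matrices have size n.+1, so the last index is n. *)
Let w : 'cV[R]_n.+1 := \col_i (g - f)`_i.

Lemma size_sub_companion : (size (g - f)%R <= n.+1)%N.
Proof.
apply/leq_sizeP => j le_j; rewrite coefB.
have [->|ne_j] := eqVneq j n.+1.
  have lead p : p \is monic -> size p = n.+2 -> p`_n.+1 = 1.
    by move=> /monicP; rewrite lead_coefE => + p_size; rewrite p_size.
  by rewrite !lead // subrr.
by rewrite !nth_default ?subrr // ?f_size ?g_size ltn_neqAle eq_sym ne_j.
Qed.

Lemma horner_sub_companion : horner_mx C (g - f) *m delta_mx 0 (0 : 'I_1) = w.
Proof. by rewrite horner_companion_delta0 // size_sub_companion. Qed.

Lemma companion_sub : C - D = w *m delta_mx (0 : 'I_1) ord_max.
Proof.
apply/matrixP => i j; rewrite !mxE big_ord1 !mxE eqxx /= -val_eqE /= eqSS.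
case: eqP => _; last by rewrite subrr mulr0.
by rewrite mulr1 coefB opprK addrC.
Qed.

Implicit Types (p q : {poly R}) (v : 'cV[R]_n.+1) (A B M : 'M[R]_n.+1).

(** Membership in J = R[C] w, the image in R^n of the ideal generated by g - f
    in R[X]/(f). *)
Definition in_ideal (v : 'cV[R]_n.+1) := exists q, v = horner_mx C q *m w.

(** All columns of the matrix lie in J. *)
Definition cols_in_ideal (B : 'M[R]_n.+1) := forall j, in_ideal (col j B).

Lemma in_idealD u v : in_ideal u -> in_ideal v -> in_ideal (u + v).
Proof. by move=> [p ->] [q ->]; exists (p + q); rewrite rmorphD mulmxDl. Qed.

Lemma in_idealZ a v : in_ideal v -> in_ideal (a *: v).
Proof. by move=> [q ->]; exists (a *: q); rewrite linearZ /= scalemxAl. Qed.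

Lemma in_idealM p v : in_ideal v -> in_ideal (horner_mx C p *m v).
Proof. by move=> [q ->]; exists (p * q); rewrite rmorphM mulmxA. Qed.

Lemma in_ideal0 : in_ideal 0.
Proof. by exists 0; rewrite rmorph0 mul0mx. Qed.

Lemma cols_in_ideal0 : cols_in_ideal 0.
Proof. by move=> j; rewrite linear0; apply: in_ideal0. Qed.

Lemma cols_in_idealD A B :
  cols_in_ideal A -> cols_in_ideal B -> cols_in_ideal (A + B).
Proof. by move=> AJ BJ j; rewrite linearD; apply: in_idealD (AJ j) (BJ j). Qed.

Lemma cols_in_idealZ a B : cols_in_ideal B -> cols_in_ideal (a *: B).
Proof. by move=> BJ j; rewrite linearZ; apply: in_idealZ (BJ j). Qed.

Lemma cols_in_idealMl p B :
  cols_in_ideal B -> cols_in_ideal (horner_mx C p *m B).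
Proof. by move=> BJ j; rewrite col_mulmx; apply: in_idealM (BJ j). Qed.

Lemma cols_in_idealMr A B : cols_in_ideal B -> cols_in_ideal (B *m A).
Proof.
move=> BJ j; rewrite col_mulmx.
have -> : B *m col j A = \sum_k A k j *: col k B.
  apply/colP => i; rewrite summxE mxE; apply: eq_bigr => k _.
  by rewrite !mxE mulrC.
by elim/big_ind: _ => [||k _]; [apply: in_ideal0 | apply: in_idealD |
  apply: in_idealZ (BJ k)].
Qed.

Lemma cols_in_ideal_outer v (u : 'rV_n.+1) :
  in_ideal v -> cols_in_ideal (v *m u).
Proof.
by move=> vJ j; rewrite col_mulmx [col j u]mx11_scalar mul_mx_scalar;
  apply: in_idealZ.
Qed.

Lemma in_ideal_gen : in_ideal w.
Proof. by exists 1; rewrite rmorph1 mul1mx. Qed.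

Lemma in_alg2_decomp M : in_alg2 C D M ->
  exists p, exists2 B, cols_in_ideal B & M = horner_mx C p + B.
Proof.
elim=> [|||A B _ [p [A' A'J ->]] _ [q [B' B'J ->]]|a A _ [p [A' A'J ->]]
  |A B _ [p [A' A'J ->]] _ [q [B' B'J ->]]].
- by exists 1, 0; [apply: cols_in_ideal0 | rewrite !rmorph1 addr0].
- exists 'X, 0; [exact: cols_in_ideal0 | by rewrite horner_mx_X addr0].
- exists 'X, (-1 *: (C - D)); last first.
    by rewrite horner_mx_X scaleN1r opprB addrC subrK.
  apply: cols_in_idealZ; rewrite companion_sub.
  exact/cols_in_ideal_outer/in_ideal_gen.
- exists (p + q), (A' + B'); first exact: cols_in_idealD.
  by rewrite rmorphD addrACA.
- exists (a *: p), (a *: A'); first exact: cols_in_idealZ.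
  by rewrite linearZ scalerDr.
exists (p * q), (horner_mx C p *m B' + A' *m (horner_mx C q + B')).
  by apply: cols_in_idealD; [apply: cols_in_idealMl | apply: cols_in_idealMr].
by rewrite rmorphM mulmxDl mulmxDr addrA.
Qed.

(** The column of index j of (q h)(C) is (q h)(C) C^j e_0 = (q X^j)(C) w, where
    h = g - f. *)
Lemma cols_in_ideal_horner q : cols_in_ideal (horner_mx C (q * (g - f))).
Proof.
move=> j; exists (q * 'X^j).
have -> : col j (horner_mx C (q * (g - f))) =
    horner_mx C (q * (g - f)) *m (horner_mx C 'X^j *m delta_mx 0 (0 : 'I_1)).
  by rewrite colE rmorphXn /= horner_mx_X (@companion_exp_delta _ _ f j 0 j)
    ?addn0.
rewrite -horner_sub_companion !mulmxA; congr (_ *m _).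
by rewrite -[LHS]rmorphM -[RHS]rmorphM mulrAC.
Qed.

(** The first column of the second summand is q(C) w for some q; subtracting
    (q h)(C), h = g - f, makes it vanish. *)
Lemma in_alg2_direct M : in_alg2 C D M ->
  exists p, exists B, [/\ (size p <= n.+1)%N, cols_in_ideal B, col 0 B = 0 &
    M = horner_mx C p + B].
Proof.
case/in_alg2_decomp => p [B BJ ->]; have [q q_eq] := BJ 0.
exists (rmodp (p + q * (g - f)) f), (B - horner_mx C (q * (g - f))); split.
- exact: size_modp_companion.
- rewrite -scaleN1r; apply/cols_in_idealD/cols_in_idealZ => //.
  exact: cols_in_ideal_horner.
- rewrite linearB /= q_eq colE rmorphM -mulmxA -/C.
  by rewrite horner_sub_companion subrr.
by rewrite horner_companion_modp // rmorphD /= addrACA subrr addr0.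
Qed.

Lemma in_alg2_horner p : in_alg2 C D (horner_mx C p).
Proof.
elim/poly_ind: p => [|p c IHp].
  by rewrite rmorph0 -(scale0r 1%:M); apply/in_alg2_scale/in_alg2_1.
rewrite rmorphD rmorphM /= horner_mx_X horner_mx_C -scalemx1.
apply: in_alg2_add; first by apply: in_alg2_mul => //; apply: in_alg2_l.
by apply/in_alg2_scale/in_alg2_1.
Qed.

(** By descending induction on j: the row of index j + 1 of D is
    e_j^T - g_(j+1) e_last^T. *)
Lemma in_alg2_outer (j : 'I_n.+1) :
  in_alg2 C D (w *m delta_mx (0 : 'I_1) j).
Proof.
have last_in : in_alg2 C D (w *m delta_mx (0 : 'I_1) ord_max).
  rewrite -companion_sub -scaleN1r; apply: in_alg2_add; first exact: in_alg2_l.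
  exact/in_alg2_scale/in_alg2_r.
move: {2}(n - j)%N (erefl (n - j)%N) => t; elim: t j => [|t IHt] j.
  move/eqP; rewrite subn_eq0 => le_nj; rewrite (_ : j = ord_max) //.
  by apply/val_inj/eqP; rewrite eqn_leq le_nj -ltnS ltn_ord.
move=> t_eq; have lt_jn : (j.+1 < n.+1)%N by rewrite ltnS -subn_gt0 t_eq.
pose k := Ordinal lt_jn.
have -> : w *m delta_mx (0 : 'I_1) j =
    (w *m delta_mx (0 : 'I_1) k) *m D + g`_k *: (w *m delta_mx (0 : 'I_1)
      ord_max).
  rewrite -mulmxA -rowE scalemxAr -mulmxDr; congr (_ *m _).
  apply/rowP => i; rewrite !mxE /= -!val_eqE /= !eqSS [i == j :> nat]eq_sym.
  case: (eqVneq (val i) n) => [->|_]; last by rewrite mulr0 addr0.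
  by rewrite mulr1 addNr ltn_eqF.
apply/in_alg2_add/in_alg2_scale => //; apply/in_alg2_mul/in_alg2_r/IHt.
by rewrite /= subnS t_eq.
Qed.

Lemma cols_expand m (B : 'M[R]_(m, n.+1)) :
  B = \sum_j col j B *m delta_mx (0 : 'I_1) j.
Proof.
apply/matrixP => i j; rewrite summxE (bigD1 j) //= !mxE big_ord1 !mxE !eqxx.
rewrite mulr1 big1 ?addr0 // => k /negPf njk.
by rewrite !mxE big_ord1 !mxE [j == k]eq_sym njk andbF mulr0.
Qed.

Lemma companion_exp_sub_cols t : cols_in_ideal (D ^+ t - C ^+ t).
Proof.
elim: t => [|t IHt]; first by rewrite subrr; apply: cols_in_ideal0.
have -> : D ^+ t.+1 - C ^+ t.+1 =
    -1 *: ((C - D) *m D ^+ t) + horner_mx C 'X *m (D ^+ t - C ^+ t).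
  rewrite horner_mx_X scaleN1r mulmxBl mulmxBr !exprS !mulmxE.
  by rewrite opprB addrA subrK.
apply/cols_in_idealD/cols_in_idealMl/IHt/cols_in_idealZ/cols_in_idealMr.
by rewrite companion_sub; apply/cols_in_ideal_outer/in_ideal_gen.
Qed.

(** Both powers shift e_j to e_(t+j) as long as t + j does not exceed the last
    index, here n. *)
Lemma companion_exp_sub_col0 t (j : 'I_n.+1) : (t + j <= n)%N ->
  col j (D ^+ t - C ^+ t) = 0.
Proof.
rewrite -ltnS => lt_tj; rewrite linearB /= !colE.
by rewrite !(@companion_exp_delta _ _ _ t j (Ordinal lt_tj)) // subrr.
Qed.

Lemma companion_exp_sub_col t (j : 'I_n.+1) : (t + j = n)%N ->
  col j (D ^+ t.+1 - C ^+ t.+1) = - w.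
Proof.
move=> t_eq; rewrite linearB /= !colE !exprS -!mulmxA.
rewrite !(@companion_exp_delta _ _ _ t j ord_max) // -mulmxBl -opprB mulNmx.
by rewrite companion_sub -mulmxA mul_delta_mx [delta_mx _ _]mx11_scalar mxE
  mulmx1.
Qed.

Variable m : nat.
Local Notation k := (n.+1 - m)%N.
Local Notation L := (listed m C D).

Lemma mem_listed_power i : (i < n.+1)%N -> C ^+ i \in L.
Proof.
by move=> lt_i; rewrite mem_cat map_f // mem_iota.
Qed.

Lemma mem_listed_prod i j : (i < k)%N -> (0 < j <= n)%N ->
  C ^+ i *m D ^+ j \in L.
Proof.
move=> lt_i lt_j; rewrite mem_cat; apply/orP; right.
by apply: allpairs_f; rewrite mem_iota ?add1n.
Qed.

Lemma in_span_listed_horner p : in_span L (horner_mx C p).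
Proof.
have mod_size := size_modp_companion f_monic f_size p.
rewrite -horner_companion_modp // -(poly_coef_small mod_size) horner_mx_poly.
apply: in_span_sum => i _.
by apply/in_spanZ/mem_in_span/mem_listed_power.
Qed.

Lemma in_span_listed_prod p j : (size p <= k)%N -> (0 < j <= n)%N ->
  in_span L (horner_mx C p *m D ^+ j).
Proof.
move=> p_size j_bnd; rewrite -(poly_coef_small p_size).
rewrite horner_mx_poly mulmx_suml.
apply: in_span_sum => i _; rewrite -scalemxAl.
exact/in_spanZ/mem_in_span/mem_listed_prod.
Qed.

(** J is spanned over R by w, Cw, ..., C^(k-1) w, where k = n.+1 - m: every
    element of J is r(C) w with r of degree < k. *)
Definition ideal_spanned_below :=
  forall q, exists2 r : {poly R}, (size r <= k)%N &
    horner_mx C q *m w = horner_mx C r *m w.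

(** Matrices with columns in J whose nonzero columns are among the last t: the
    first of these columns is eliminated by a combination of the
    C^i (D^(t+1) - C^(t+1)) with i < k. *)
Lemma in_span_listed_cols t B : ideal_spanned_below -> (t <= n)%N ->
    cols_in_ideal B -> (forall j : 'I_n.+1, (j < n.+1 - t)%N -> col j B = 0) ->
  in_span L B.
Proof.
move=> genJ; elim: t B => [|t IHt] B le_tn BJ B0.
  have -> : B = 0; last exact: in_span0.
  apply/matrixP => i j; have /colP/(_ i) := B0 j (ltn_ord j).
  by rewrite !mxE.
have lt_j : (n - t < n.+1)%N by rewrite ltnS leq_subr.
pose j0 := Ordinal lt_j.
have [q] := BJ j0; have [r r_size ->] := genJ q; move=> col_eq.
(* Adding r(C) (D^(t+1) - C^(t+1)) to B cancels the column j0, because the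
   column j0 of D^(t+1) - C^(t+1) is - w. *)
pose B' := B + horner_mx C r *m (D ^+ t.+1 - C ^+ t.+1).
have -> : B = B' + (horner_mx C (r * 'X^(t.+1)) +
  -1 *: (horner_mx C r *m D ^+ t.+1)).
  rewrite /B' mulmxBr rmorphM rmorphXn /= horner_mx_X -mulmxE scaleN1r.
  by rewrite -addrA [X in B + X]addrA subrK subrr addr0.
apply: in_spanD; last first.
  by apply/in_spanD/in_spanZ/in_span_listed_prod;
    first exact: in_span_listed_horner.
apply: IHt; first exact: ltnW.
  by apply/cols_in_idealD/cols_in_idealMl/companion_exp_sub_cols.
move=> j; rewrite subSn ?(ltnW le_tn) // ltnS leq_eqVlt =>
  /orP[/eqP j_eq|lt_jt].
  have -> : j = j0 by apply/val_inj.
  rewrite linearD /= col_mulmx companion_exp_sub_col ?subnKC ?(ltnW le_tn) //.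
  by rewrite mulmxN col_eq subrr.
rewrite linearD /= col_mulmx B0 ?subSS //
  companion_exp_sub_col0 ?mulmx0 ?addr0 //.
by rewrite addSn -ltn_subRL.
Qed.

Lemma listed_in_alg2 A : A \in L -> in_alg2 C D A.
Proof.
have in_exp X i : in_alg2 C D X -> in_alg2 C D (X ^+ i).
  move=> X_in; elim: i => [|i IHi]; first by rewrite expr0; apply: in_alg2_1.
  by rewrite exprS; apply: in_alg2_mul.
have [C_in D_in] : in_alg2 C D C /\ in_alg2 C D D.
  by split; [apply: in_alg2_l | apply: in_alg2_r].
rewrite mem_cat => /orP[/mapP[i _ ->]|/allpairsP[[i j] /= [_ _ ->]]];
  first exact: in_exp.
by apply: in_alg2_mul; apply: in_exp.
Qed.

Lemma spans_listed : ideal_spanned_below -> spans L (in_alg2 C D).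
Proof.
move=> genJ M; split; last first.
  apply: in_span_ind;
    [|exact: in_alg2_add|exact: in_alg2_scale|exact: listed_in_alg2].
  by rewrite -(scale0r 1%:M); apply/in_alg2_scale/in_alg2_1.
case/in_alg2_direct => p [B [_ BJ B0 ->]]; apply: in_spanD.
  exact: in_span_listed_horner.
apply: (@in_span_listed_cols n) => // j; rewrite subSnn ltnS leqn0 => /eqP j0.
by rewrite (_ : j = 0) //; apply/val_inj.
Qed.

Lemma in_span_listedP M : in_span L M ->
  exists p, exists2 r : 'I_n -> {poly R}, forall j, (size (r j) <= k)%N &
    M = horner_mx C p + \sum_j horner_mx C (r j) *m D ^+ j.+1.
Proof.
move: M; apply: in_span_ind =>
  [|_ _ [p [r r_size ->]] [q [s s_size ->]]|a _ [p [r r_size ->]]|M].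
- exists 0, (fun=> 0) => [j|]; first by rewrite size_poly0.
  by rewrite rmorph0 add0r big1 // => j _; rewrite mul0mx.
- exists (p + q), (fun j => r j + s j) => [j|].
    by rewrite (leq_trans (size_polyD _ _)) // geq_max r_size s_size.
  rewrite rmorphD addrACA -big_split; congr (_ + _); apply: eq_bigr => j _.
  by rewrite rmorphD mulmxDl.
- exists (a *: p), (fun j => a *: r j) => [j|].
    exact: leq_trans (size_scale_leq _ _) (r_size j).
  rewrite linearZ scalerDr scaler_sumr; congr (_ + _); apply: eq_bigr => j _.
  by rewrite linearZ /= scalemxAl.
rewrite mem_cat => /orP[/mapP[i _ ->]|/allpairsP[[j i] /= []]].
  exists 'X^i, (fun=> 0) => [j|]; first by rewrite size_poly0.
  rewrite rmorphXn /= horner_mx_X big1 ?addr0 // => j _.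
  by rewrite /= rmorph0 mul0mx.
rewrite !mem_iota add0n /= => /andP[j_gt0 lt_j] lt_i ->.
have lt_jn : (j.-1 < n)%N by rewrite -ltnS prednK.
exists 0, (fun j' => if j' == Ordinal lt_jn then 'X^i else 0) => [j'|].
  by case: eqP => _; rewrite ?size_polyXn ?size_poly0.
rewrite rmorph0 add0r (bigD1 (Ordinal lt_jn)) //= eqxx big1 ?addr0.
  by rewrite rmorphXn /= horner_mx_X prednK.
by move=> j' /negPf->; rewrite rmorph0 mul0mx.
Qed.

(** The matrix C^k w e_1^T lies in the algebra.  An expansion of it over the
    listed matrices reads p(C) + sum_j r_j(C) D^j, and since its first column is
    0 it equals sum_j r_j(C) (D^j - C^j).  Only the largest exponent of D
    contributes to the column of index 1, which gives C^k w = - r_j(C) w for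
    that j.  The hypothesis 0 < n ensures that the column of index 1 exists. *)
Lemma spans_listed_annihilator : (0 < n)%N -> spans L (in_alg2 C D) ->
  exists r : {poly R}, [/\ r \is monic, size r = k.+1 & horner_mx C r *m w = 0].
Proof.
move=> n_gt0 spansL; pose j1 : 'I_n.+1 := inord 1.
have j1E : j1 = 1%N :> nat by rewrite inordK.
pose M := horner_mx C 'X^k *m (w *m delta_mx (0 : 'I_1) j1).
have M_in : in_alg2 C D M by apply/in_alg2_mul/in_alg2_outer/in_alg2_horner.
have [p [r r_size M_eq]] := in_span_listedP ((spansL M).1 M_in).
have colM j : col j M = (j == j1)%:R *: (horner_mx C 'X^k *m w).
  rewrite /M mulmxA col_mulmx [X in _ *m X]mx11_scalar !mxE eqxx /=.
  by rewrite mul_mx_scalar.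
pose s := p + \sum_(j < n) r j * 'X^(j.+1).
have s_eq : horner_mx C s = horner_mx C p +
  \sum_(j < n) horner_mx C (r j) *m C ^+ j.+1.
  rewrite rmorphD rmorph_sum; congr (_ + _); apply: eq_bigr => j _.
  by rewrite rmorphM rmorphXn /= horner_mx_X.
have M_eq' : M = horner_mx C s +
  \sum_j horner_mx C (r j) *m (D ^+ j.+1 - C ^+ j.+1).
  rewrite s_eq -addrA -big_split M_eq; congr (_ + _); apply: eq_bigr => j _.
  by rewrite /= mulmxBr addrC subrK.
have s0 : horner_mx C s = 0.
  rewrite -horner_companion_modp // (horner_companion_eq0 f_monic f_size)
    ?rmorph0 //.
  have := colM 0; rewrite -val_eqE /= j1E scale0r M_eq' linearD linear_sum /=.
  rewrite big1 ?addr0 ?colE // => j _.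
  by rewrite col_mulmx companion_exp_sub_col0 ?mulmx0 // addn0.
move: (colM j1); rewrite eqxx scale1r M_eq' s0 add0r linear_sum /=.
have lt_n1 : (n.-1 < n)%N by rewrite prednK.
rewrite (bigD1 (Ordinal lt_n1)) //= big1 => [|j nej]; last first.
  rewrite col_mulmx companion_exp_sub_col0 ?mulmx0 //
    j1E addn1 ltn_neqAle ltn_ord andbT.
  by apply: contraNneq nej => eq_n; apply/eqP/val_inj;
    apply: (congr1 predn eq_n).
rewrite col_mulmx companion_exp_sub_col ?j1E ?addn1 ?prednK // addr0 mulmxN =>
  eq_w.
exists ('X^k + r (Ordinal lt_n1)).
have r_lt : (size (r (Ordinal lt_n1)) < size ('X^k : {poly R}))%N.
  by rewrite size_polyXn ltnS.
split; last by rewrite rmorphD mulmxDl -eq_w addNr.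
  by rewrite monicE lead_coefDl // lead_coefXn.
by rewrite size_polyDl // size_polyXn.
Qed.

(** The vectors w, Cw, ..., C^(k-1) w are linearly independent over R. *)
Definition ideal_free_below :=
  forall r : {poly R}, (size r <= k)%N -> horner_mx C r *m w = 0 -> r = 0.

(** The basis consists of the C^i, and of the C^i w e_j^T with i < k and
    j > 0. *)
Lemma in_alg2_free : ideal_spanned_below -> ideal_free_below ->
  free_of_rank (in_alg2 C D) (n.+1 + k * n).
Proof.
move=> genJ freeJ; pose T : finType := ('I_n.+1 + 'I_k * 'I_n)%type.
pose e (x : T) : 'M[R]_n.+1 := match x with
  | inl i => C ^+ i
  | inr ij => (C ^+ ij.1 *m w) *m delta_mx (0 : 'I_1) (lift ord0 ij.2)
  end.
have <- : #|T| = (n.+1 + k * n)%N by rewrite card_sum card_prod !card_ord.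
have sumE (c1 : nat -> R) (c2 : nat -> 'I_n -> R) :
    \sum_(x : T)
      (match x with inl i => c1 i | inr ij => c2 ij.1 ij.2 end) *: e x =
    horner_mx C (\poly_(i < n.+1) c1 i) +
    \sum_j (horner_mx C (\poly_(i < k) c2 i j) *m w)
      *m delta_mx (0 : 'I_1) (lift ord0 j).
  rewrite big_sumType /= horner_mx_poly; congr (_ + _).
  rewrite -(pair_bigA _ (fun (i : 'I_k) (j : 'I_n) =>
    c2 i j *: e (inr (i, j)))) exchange_big.
  apply: eq_bigr => j _; rewrite horner_mx_poly !mulmx_suml.
  by apply: eq_bigr => i _; rewrite /= -!scalemxAl.
apply: (@free_of_rank_finType _ _ _ T e) => [[i|[i j]]|M|c c0].
- exact/listed_in_alg2/mem_listed_power.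
- rewrite /= -mulmxA; apply: in_alg2_mul; last exact: in_alg2_outer.
  by rewrite -[C in C ^+ _]horner_mx_X -rmorphXn; apply: in_alg2_horner.
- case/in_alg2_direct => p [B [p_size BJ B0 ->]].
  have [r r_size r_eq] : exists2 r : 'I_n -> {poly R},
      forall j, (size (r j) <= k)%N &
      forall j, col (lift ord0 j) B = horner_mx C (r j) *m w.
    apply: (@fin_all_exists2 _ (fun=> {poly R})
      (fun _ s => (size s <= k)%N : Prop)
      (fun j s => col (lift ord0 j) B = horner_mx C s *m w)) => j.
    have [q ->] := BJ (lift ord0 j).
    by have [s] := genJ q; exists s.
  exists (fun x : T =>
    match x with inl i => p`_i | inr ij => (r ij.2)`_ij.1 end).
  rewrite (sumE (fun i => p`_i) (fun i j => (r j)`_i)) poly_coef_small //;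
    congr (_ + _).
  rewrite [LHS]cols_expand big_ord_recl B0 mul0mx add0r; apply: eq_bigr => j _.
  by rewrite poly_coef_small // r_eq.
(* The coefficients are extended by zero so as to define polynomials. *)
pose c1 i := if insub i is Some i' then c (inl i') else 0.
pose c2 i j := if insub i is Some i' then c (inr (i', j)) else 0.
have : \sum_(x : T)
    (match x with inl i => c1 i | inr ij => c2 ij.1 ij.2 end) *: e x = 0.
  rewrite -[RHS]c0; apply: eq_bigr => -[i|[i j]] _; rewrite /c1 /c2 /= valK //.
rewrite sumE => sum0.
have c1_0 : \poly_(i < n.+1) c1 i = 0.
  apply: (horner_companion_inj f_monic f_size (size_poly _ _)).
  have /(congr1 (col 0)) := sum0; rewrite linear0 linearD linear_sum /=.
  rewrite big1 ?addr0; first by rewrite colE.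
  move=> j _; rewrite col_mulmx [X in _ *m X]mx11_scalar !mxE.
  by rewrite mul_mx_scalar scale0r.
have c2_0 j : \poly_(i < k) c2 i j = 0.
  apply: freeJ; first exact: size_poly.
  have /(congr1 (col (lift ord0 j))) := sum0.
  rewrite c1_0 rmorph0 add0r linear0 linear_sum (bigD1 j) //= big1 ?addr0.
    by rewrite col_mulmx [X in _ *m X = _ -> _]mx11_scalar !mxE !eqxx mulmx1.
  move=> j' nej; rewrite col_mulmx [X in _ *m X]mx11_scalar !mxE /=.
  by rewrite (inj_eq lift_inj) eq_sym (negPf nej) mul_mx_scalar scale0r.
case=> [i|[i j]].
  have := congr1 (fun p : {poly R} => p`_i) c1_0.
  by rewrite coef0 coef_poly ltn_ord /c1 valK.
have := congr1 (fun p : {poly R} => p`_i) (c2_0 j).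
by rewrite coef0 coef_poly ltn_ord /c2 valK.
Qed.

Lemma horner_ideal_eq0 q :
  horner_mx C q *m w = 0 <-> exists s, q * (g - f) = s * f.
Proof.
rewrite -horner_sub_companion mulmxA -[horner_mx C q *m _]rmorphM; split.
  move=> /(horner_companion_eq0 f_monic f_size) mod0.
  exists (rdivp (q * (g - f)) f).
  by rewrite [LHS](rdivp_eq f_monic) mod0 addr0.
move=> [s ->].
by rewrite rmorphM /= horner_companion_root // mulr0 mul0mx.
Qed.

Lemma annihilator_ideal_spanned (r : {poly R}) :
    r \is monic -> size r = k.+1 -> horner_mx C r *m w = 0 ->
  ideal_spanned_below.
Proof.
move=> r_monic r_size rw0 q; exists (rmodp q r).
  by rewrite -ltnS -r_size ltn_rmodp monic_neq0.
rewrite {1}(rdivp_eq r_monic q) rmorphD rmorphM /= mulmxDl -mulmxE -mulmxA.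
by rewrite rw0 mulmx0 add0r.
Qed.

End TwoCompanions.

Theorem corollary8p2 (R : idomainType) (n : nat) (f g : {poly R})
    (n_ge1 : (1 <= n)%N)
    (f_monic : f \is monic) (deg_f : size f = n.+1)
    (g_monic : g \is monic) (deg_g : size g = n.+1) :
  let C : 'M[R]_n := companion n f in
  let D : 'M[R]_n := companion n g in
  let d : {poly {fraction R}} :=
    monic_gcd (to_frac_poly f) (to_frac_poly g) in
  let m : nat := (size d).-1 in
  let N : nat := (n + (n - m) * (n - 1))%N in
  (spans (listed m C D) (in_alg2 C D) <-> has_coefs_in_base d) /\
  (has_coefs_in_base d -> free_of_rank (in_alg2 C D) N) /\
  (integrally_closed R -> free_of_rank (in_alg2 C D) N).
Proof.
case: n n_ge1 deg_f deg_g => // n _ f_size g_size C D d m N.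
have spannedJ : has_coefs_in_base d -> ideal_spanned_below n f g m.
  case/(base_gcd_annihilator f_monic f_size) => r [r_monic r_size rh].
  apply: (annihilator_ideal_spanned r_monic r_size).
  exact/(horner_ideal_eq0 f_monic f_size g_monic g_size).
have freeJ : ideal_free_below n f g m.
  move=> r r_size /(horner_ideal_eq0 f_monic f_size g_monic g_size)[q].
  exact: (annihilator_small f_monic f_size r_size).
have freeA : has_coefs_in_base d -> free_of_rank (in_alg2 C D) N.
  move=> /spannedJ genJ; rewrite /N subSS subn0.
  exact: (in_alg2_free f_monic f_size g_monic g_size genJ freeJ).
split; last first.
  split=> // /(integrally_closed_base_gcd g f_monic); exact: freeA.
split; last by move/spannedJ; exact: (spans_listed f_monic f_size g_monic g_size).
have [n_gt0|] := ltnP 0 n; last first.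
  by rewrite leqn0 => /eqP n0 _; apply: deg1_base_gcd; rewrite // f_size n0.
case/(spans_listed_annihilator f_monic f_size n_gt0) => r [r_monic r_size].
move=> /(horner_ideal_eq0 f_monic f_size g_monic g_size)[q].
exact: (annihilator_base_gcd f_monic f_size r_monic r_size).
Qed.
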